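(* For $n=2$ and for $n=3$, the function $$F\mapsto e^{\|\log U\|^2},\qquad F\in\mathrm{GL}^+(n),\quad U=\sqrt{F^TF},$$ is not rank-one convex.
   Context: $\mathrm{GL}^+(n)=\{F\in\mathbb{R}^{n\times n}:\det F>0\}$; $\log U$ is the principal (symmetric) logarithm of the symmetric positive definite matrix $U$; $\|X\|^2=\mathrm{tr}(XX^T)$. A function $W$ is rank-one convex on $\mathrm{GL}^+(n)$ if it is convex on every closed line segment contained in $\mathrm{GL}^+(n)$ whose end points differ by a matrix of rank one. *)

(* Defs.v *)
From HB Require Import structures.
From mathcomp Require Import all_boot all_order all_algebra.
From mathcomp Require Import all_classical all_reals all_analysis.

Set Implicit Arguments.
Unset Strict Implicit.
Unset Printing Implicit Defensive.

Import Order.TTheory GRing.Theory Num.Theory.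
Import numFieldNormedType.Exports.

Local Open Scope classical_set_scope.
Local Open Scope ring_scope.

Section MatrixFunctions.
Context {R : realType} {n : nat}.
Implicit Types (A U X F : 'M[R]_n) (W : 'M[R]_n -> R).

Definition GLplus : set 'M[R]_n := [set F | 0 < \det F].

Definition frobenius_sq X : R := \tr (X *m X^T).

Definition spd A : Prop :=
  A^T = A /\ forall x : 'cV[R]_n, x != 0 -> 0 < (x^T *m A *m x) 0 0.

(* The symmetric positive definite U with U *m U = A. It exists and is unique
   when A is symmetric positive definite; the default value 0 is never used
   for A = F^T *m F with F invertible. *)
Definition spd_sqrt A : 'M[R]_n := xget 0 [set U | spd U /\ U *m U = A].

(* The series converges for every X (entrywise, equivalently in norm). *)
Definition expmx X : 'M[R]_n :=
  limn (series (fun k : nat => (k`!%:R)^-1 *: X ^+ k)).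

(* The symmetric X with expmx X = U. It exists and is unique when U is
   symmetric positive definite; the default value 0 is never used for such U. *)
Definition logmx U : 'M[R]_n := xget 0 [set X | X^T = X /\ expmx X = U].

Definition right_stretch F : 'M[R]_n := spd_sqrt (F^T *m F).

Definition segment (F1 F2 : 'M[R]_n) : set 'M[R]_n :=
  [set (1 - t) *: F1 + t *: F2 | t in [set t : R | 0 <= t <= 1]].

(* W is total, but only its values on GLplus matter. *)
Definition rank_one_convex W : Prop :=
  forall F1 F2 : 'M[R]_n, segment F1 F2 `<=` GLplus ->
    \rank (F2 - F1) = 1%N -> convex_function (segment F1 F2) W.

End MatrixFunctions.

(* Main.v *)
Require Import Defs.
From mathcomp Require Import all_boot all_order all_algebra.
From mathcomp Require Import all_classical all_reals all_analysis.
From mathcomp Require Import spectral complex ring lra.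

Set Implicit Arguments.
Unset Strict Implicit.
Unset Printing Implicit Defensive.

Import Order.TTheory GRing.Theory Num.Theory.
Import numFieldNormedType.Exports.

Local Open Scope classical_set_scope.
Local Open Scope ring_scope.

(** The function fails even rank-one quasiconvexity: on a suitable segment its
    value at an interior point is larger than at both end points.

    Replacing a planar F by c F adds 2 ln c * ln (det F) and a constant to
    ||log U||^2. Since det is affine along a rank-one segment, the choice of c
    can tilt ||log U||^2, seen as a function of ln (det F), by any slope.
    Hence as soon as some rank-one segment has a point where ||log U||^2 lies
    strictly above the chord in the variable ln (det F), a suitable multiple of
    that segment has a point where ||log U||^2 exceeds both end values, and so
    does its exponential, as exp is increasing.

    Such a segment is found among the matrices with rows (-p, d) and (-d, s),
    where p varies. They are symmetric up to a reflection, so that their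
    singular values x > y solve x - y = p + s and x y = d^2 - p s, that is,
    (x - s) (y + s) = d^2. With s = 64 and d^2 = 465920 this has the three
    solutions (2^6 3^4, 3^3), (2^8 3^2, 2^4 3^2) and (2^6 3^3, 2^3 3^3), and
    the second one is between the other two: its p is their convex combination
    with weights 8/45 and 37/45. All logarithms are then integral combinations
    of ln 2 and ln 3, and the two inequalities between the squared norms follow
    from 3^17 < 2^27. In dimension 2 + m the matrices are extended by an
    identity block, which contributes singular values 1 and thus nothing to
    the norm of the logarithm.

    The rest is the evaluation of the matrix functions. The square root and
    the logarithm are characterised by U^2 = F^T F and exp X = U, so that they
    can be read off an orthogonal diagonalisation of F^T F once they are known
    to be unique among symmetric matrices. Uniqueness comes from
    symmetric_diag_conj (real symmetric matrices are diagonalisable) and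
    diag_conj_inj (an injective function of the eigenvalues determines the
    matrix); frobenius_sq_log_stretch sums this up. *)

(** * Functions of diagonalisable matrices *)

Definition diag_conj (R : realType) (n : nat) (P : 'M[R]_n) (d : 'rV[R]_n) :
  'M[R]_n := invmx P *m diag_mx d *m P.

(** Over the complex numbers a real symmetric matrix is Hermitian, hence
    unitarily diagonalisable with real eigenvalues. It is therefore similar over
    R[i] to a real diagonal matrix, and two real matrices that are similar over
    R[i] are similar over R. *)
Lemma symmetric_diag_conj (R : realType) (n : nat) (X : 'M[R]_n) :
  X^T = X -> exists P d, P \in unitmx /\ X = diag_conj P d.
Proof.
move=> symX; pose toC := real_complex R; pose XC := map_mx toC X.
have toC_real m1 m2 (A : 'M[R]_(m1, m2)) : map_mx toC A \is a mxOver Num.real.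
  by apply/mxOverP => i j; rewrite mxE; apply/complex_realP; exists (A i j).
have real_toC m1 m2 (A : 'M[R[i]]_(m1, m2)) : A \is a mxOver Num.real ->
    exists B, A = map_mx toC B.
  move=> /mxOverP realA; exists (map_mx (@complex.Re R) A).
  by apply/matrixP => i j; rewrite !mxE [RHS]RRe_real.
have hermXC : XC \is hermsymmx.
  apply: realsym_hermsym; last exact: toC_real.
  by apply/is_hermitianmxP; rewrite expr0 scale1r map_mx_id// map_trmx symX.
have /hermitian_normalmx/orthomx_spectralP := hermXC.
have /real_toC[d ->] := hermitian_spectral_diag_real hermXC.
move: (spectralmx XC) (spectral_unit XC) => P uP eqXC.
have simXC : similar_in unitmx XC (diag_mx (map_mx toC d)).
  exists P => //; apply/similarP => //.
  by rewrite [in LHS]eqXC -mulmxA mulKVmx.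
have [|Q] := real_similar simXC (toC_real _ _ _).
  by rewrite -map_diag_mx; exact: toC_real.
rewrite inE => /andP[/real_toC[Q0 ->] uQ] /(similarP uQ) eqQ.
have uQ0 : Q0 \in unitmx by rewrite -(map_unitmx toC).
exists Q0, d; split=> //; rewrite /diag_conj -mulmxA.
apply: (canRL (mulKmx uQ0)).
apply: (map_mx_inj (f := toC)).
by rewrite !map_mxM map_diag_mx.
Qed.

(** With M = P Q^-1 both equalities between conjugates are intertwining
    relations: f(a_i) M_ij = M_ij f(b_j) for all i and j. Where M_ij is not
    zero this gives f(a_i) = f(b_j), hence a_i = b_j. *)
Lemma diag_conj_inj (R : realType) (n : nat) (f : R -> R) (P Q : 'M[R]_n)
    (a b : 'rV[R]_n) :
  P \in unitmx -> Q \in unitmx ->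
  (forall i j, f (a 0 i) = f (b 0 j) -> a 0 i = b 0 j) ->
  diag_conj P (map_mx f a) = diag_conj Q (map_mx f b) ->
  diag_conj P a = diag_conj Q b.
Proof.
move=> uP uQ finj.
pose M := P *m invmx Q.
have conjE d e : diag_conj P d = diag_conj Q e <->
    diag_mx d *m M = M *m diag_mx e.
  rewrite /diag_conj /M; split=> [eqPQ|eqM].
    have : P *m (invmx P *m diag_mx d *m P) *m invmx Q =
           P *m (invmx Q *m diag_mx e *m Q) *m invmx Q by rewrite eqPQ.
    by rewrite !mulmxA mulmxV// mul1mx mulmxK.
  have : invmx P *m (diag_mx d *m (P *m invmx Q)) *m Q =
         invmx P *m (P *m invmx Q *m diag_mx e) *m Q by rewrite eqM.
  by rewrite !mulmxA mulVmx// mul1mx mulmxKV.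
clearbody M; rewrite !conjE => /matrixP eqM; apply/matrixP => i j.
have := eqM i j; rewrite !mul_diag_mx !mul_mx_diag !mxE ![_ * M i j]mulrC.
have [->|m0] := eqVneq (M i j) 0; first by rewrite !mul0r.
by move=> /(mulfI m0)/finj ->.
Qed.

Lemma diag_conjX (R : realType) (n : nat) (P : 'M[R]_n) (d : 'rV[R]_n) k :
  P \in unitmx ->
  diag_conj P d ^+ k = diag_conj P (map_mx (fun x => x ^+ k) d).
Proof.
move=> uP; elim: k => [|k IH].
  rewrite expr0 /diag_conj (_ : map_mx _ d = const_mx 1); last first.
    by apply/rowP => i; rewrite !mxE expr0.
  by rewrite diag_const_mx mulmx1 mulVmx.
rewrite exprS IH /diag_conj -mulmxE -!mulmxA mulKVmx// [diag_mx d *m _]mulmxA.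
rewrite mulmx_diag; congr (_ *m (diag_mx _ *m _)).
by apply/rowP => i; rewrite !mxE exprS.
Qed.

Lemma cvg_mx_entries (R : realType) (m n : nat) (u : nat -> 'M[R]_(m, n))
    (M : 'M[R]_(m, n)) :
  (forall i j, (fun k => u k i j) @ \oo --> M i j) -> u @ \oo --> M.
Proof.
move=> uM A [B nB sBA].
have uB : \forall k \near \oo, forall i j, B i j (u k i j).
  apply: filter_forall => i; apply: filter_forall => j.
  exact: (uM _ _ _ (nB i j)).
by apply: filterS uB => k; exact: sBA.
Qed.

(** Each entry of a partial sum is a fixed linear combination of partial sums of
    the scalar exponential series at the eigenvalues. *)
Lemma expmx_diag_conj (R : realType) (n : nat) (P : 'M[R]_n) (d : 'rV[R]_n) :
  P \in unitmx -> expmx (diag_conj P d) = diag_conj P (map_mx expR d).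
Proof.
move=> uP; apply: cvg_lim; first exact: norm_hausdorff.
pose S N x : R := series (exp_coeff x) N.
have diag_conjE e i j :
    diag_conj P e i j = \sum_k invmx P i k * e 0 k * P k j.
  by rewrite /diag_conj mul_mx_diag mxE; apply: eq_bigr => k _; rewrite !mxE.
apply: cvg_mx_entries => i j.
have -> : (fun N => series (fun k => k`!%:R^-1 *: diag_conj P d ^+ k) N i j) =
    (fun N => \sum_k invmx P i k * S N (d 0 k) * P k j).
  apply/funext => N; rewrite /S /series/= summxE.
  under [RHS]eq_bigr do rewrite mulr_sumr mulr_suml.
  rewrite exchange_big/=; apply: eq_bigr => l _.
  rewrite diag_conjX// mxE diag_conjE mulr_sumr; apply: eq_bigr => k _.
  by rewrite /exp_coeff !mxE/=; ring.
rewrite diag_conjE; apply: cvg_big => [|k _]; first exact: add_continuous.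
apply: cvgM; last exact: cvg_cst.
apply: cvgM; first exact: cvg_cst.
by rewrite mxE; exact: is_cvg_series_exp_coeff.
Qed.

(** The rows of P are left eigenvectors, and testing positivity on the i-th one
    gives d_i times a squared norm. *)
Lemma spd_diag_conj_gt0 (R : realType) (n : nat) (P : 'M[R]_n) (d : 'rV[R]_n) :
  P \in unitmx -> spd (diag_conj P d) -> forall i, 0 < d 0 i.
Proof.
move=> uP [_ posU] i; have := posU (row i P)^T; rewrite trmxK.
have rP : row i P *m diag_conj P d = d 0 i *: row i P.
  rewrite -row_mul /diag_conj -!mulmxA mulKVmx//.
  by apply/rowP => j; rewrite mul_diag_mx !mxE.
rewrite rP -scalemxAl !mxE; set r2 := (X in _ * X) => h.
have r2_ge0 : 0 <= r2.
  by apply: sumr_ge0 => k _; rewrite !mxE -expr2 sqr_ge0.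
have r_neq0 : (row i P)^T != 0.
  apply/eqP => /(congr1 trmx); rewrite trmxK trmx0 => rP0.
  have /matrixP/(_ 0 i) := row_mul i P (invmx P).
  by rewrite rP0 mul0mx mulmxV// !mxE eqxx => /eqP; rewrite oner_eq0.
have := h r_neq0; move: r2_ge0; rewrite le_eqVlt => /predU1P[<-|r2_gt0].
  by rewrite mulr0 ltxx.
by rewrite pmulr_lgt0.
Qed.

(** * Uniqueness and value of the logarithm of the stretch *)

Lemma spd_sqr_inj (R : realType) (n : nat) (U V : 'M[R]_n) :
  spd U -> spd V -> U *m U = V *m V -> U = V.
Proof.
move=> spdU spdV; have [symU symV] := (spdU.1, spdV.1).
have [P [a [uP eqU]]] := symmetric_diag_conj symU.
have [Q [b [uQ eqV]]] := symmetric_diag_conj symV.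
move: spdU spdV; rewrite {}eqU {}eqV => spdU spdV.
rewrite !mulmxE -!expr2 !diag_conjX//; apply: diag_conj_inj => // i j /eqP.
rewrite eqrXn2 ?ltW//; first by move=> /eqP.
- exact: spd_diag_conj_gt0 spdU i.
- exact: spd_diag_conj_gt0 spdV j.
Qed.

Lemma expmx_inj_symmetric (R : realType) (n : nat) (X Y : 'M[R]_n) :
  X^T = X -> Y^T = Y -> expmx X = expmx Y -> X = Y.
Proof.
move=> /symmetric_diag_conj[P [a [uP ->]]] /symmetric_diag_conj[Q [b [uQ ->]]].
by rewrite !expmx_diag_conj//; apply: diag_conj_inj => // i j /expR_inj.
Qed.

Lemma orthogonal_unit (R : realType) (n : nat) (Q : 'M[R]_n) :
  Q *m Q^T = 1%:M -> Q \in unitmx.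
Proof. by move=> /mulmx1_unit[]. Qed.

Lemma invmx_orthogonal (R : realType) (n : nat) (Q : 'M[R]_n) :
  Q *m Q^T = 1%:M -> invmx Q = Q^T.
Proof.
by move=> orthoQ; rewrite -[RHS](mulKmx (orthogonal_unit orthoQ)) orthoQ mulmx1.
Qed.

Lemma tr_diag_conj (R : realType) (n : nat) (Q : 'M[R]_n) (d : 'rV[R]_n) :
  Q *m Q^T = 1%:M -> (diag_conj Q d)^T = diag_conj Q d.
Proof.
move=> orthoQ; rewrite /diag_conj (invmx_orthogonal orthoQ).
by rewrite !trmx_mul tr_diag_mx trmxK mulmxA.
Qed.

Lemma spd_diag_conj (R : realType) (n : nat) (Q : 'M[R]_n) (d : 'rV[R]_n) :
  Q *m Q^T = 1%:M -> (forall i, 0 < d 0 i) -> spd (diag_conj Q d).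
Proof.
move=> orthoQ d_gt0; have uQ := orthogonal_unit orthoQ.
have invQ := invmx_orthogonal orthoQ; split=> [|x x_neq0].
  exact: tr_diag_conj.
pose y := Q *m x.
have y_neq0 : y != 0.
  apply: contraNneq x_neq0 => y0.
  by rewrite -[x](mulKmx uQ) -/y y0 mulmx0.
have -> : x^T *m diag_conj Q d *m x = y^T *m diag_mx d *m y.
  by rewrite /diag_conj invQ /y trmx_mul !mulmxA.
have -> : (y^T *m diag_mx d *m y) 0 0 = \sum_i d 0 i * y i 0 ^+ 2.
  by rewrite mul_mx_diag mxE; apply: eq_bigr => i _; rewrite !mxE; ring.
have term_ge0 i : 0 <= d 0 i * y i 0 ^+ 2 by rewrite mulr_ge0 ?sqr_ge0// ltW.
rewrite lt_neqAle; apply/andP; split; last exact: sumr_ge0.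
rewrite eq_sym psumr_eq0//; apply: contra y_neq0 => /allP y0.
apply/eqP/colP => i; rewrite [RHS]mxE; apply/eqP.
have := y0 i (mem_index_enum i).
by rewrite /= mulf_eq0 (gt_eqF (d_gt0 i))/= sqrf_eq0.
Qed.

Lemma frobenius_sq_diag_conj (R : realType) (n : nat) (Q : 'M[R]_n)
    (d : 'rV[R]_n) :
  Q *m Q^T = 1%:M ->
  frobenius_sq (diag_conj Q d) = \sum_i d 0 i ^+ 2.
Proof.
move=> orthoQ; have uQ := orthogonal_unit orthoQ.
rewrite /frobenius_sq tr_diag_conj// mulmxE -expr2 diag_conjX// /diag_conj.
rewrite mxtrace_mulC mulmxA mulmxV// mul1mx mxtrace_diag.
by apply: eq_bigr => i _; rewrite mxE.
Qed.

(** The entries of s are the singular values of F: the stretch and its logarithm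
    are conjugate by Q to the diagonal matrices of s and ln s. *)
Lemma frobenius_sq_log_stretch (R : realType) (n : nat) (Q F : 'M[R]_n)
    (s : 'rV[R]_n) :
  Q *m Q^T = 1%:M ->
  (forall i, 0 < s 0 i) ->
  F^T *m F = Q^T *m diag_mx (map_mx (fun x => x ^+ 2) s) *m Q ->
  frobenius_sq (logmx (right_stretch F)) = \sum_i ln (s 0 i) ^+ 2.
Proof.
move=> orthoQ; have uQ := orthogonal_unit orthoQ.
rewrite -(invmx_orthogonal orthoQ) => s_gt0 FF.
have stretchF : right_stretch F = diag_conj Q s.
  apply: xget_unique => [|U [spdU]].
    split; first exact: spd_diag_conj.
    by rewrite /= FF mulmxE -expr2 diag_conjX.
  rewrite FF -/(diag_conj _ _) -diag_conjX// expr2 -mulmxE.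
  by apply: spd_sqr_inj => //; exact: spd_diag_conj.
have logF : logmx (right_stretch F) = diag_conj Q (map_mx (@ln R) s).
  have expU : expmx (diag_conj Q (map_mx (@ln R) s)) = right_stretch F.
    rewrite expmx_diag_conj// stretchF; congr diag_conj.
    by apply/rowP => i; rewrite !mxE lnK ?posrE.
  apply: xget_unique => [|X [symX]]; first by split; first exact: tr_diag_conj.
  by rewrite -expU; apply: expmx_inj_symmetric => //; exact: tr_diag_conj.
rewrite logF frobenius_sq_diag_conj//.
by apply: eq_bigr => i _; rewrite mxE.
Qed.

(** * The matrices of the segment *)

Definition mx2 (R : realType) (a b c d : R) : 'M[R]_(1 + 1) :=
  block_mx a%:M b%:M c%:M d%:M.

Definition plane_map (R : realType) (m : nat) (A : 'M[R]_(1 + 1)) :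
  'M[R]_(1 + 1 + m) := block_mx A 0 0 1%:M.

Lemma mulmx2 (R : realType) (a b c d a' b' c' d' : R) :
  mx2 a b c d *m mx2 a' b' c' d' =
  mx2 (a * a' + b * c') (a * b' + b * d') (c * a' + d * c') (c * b' + d * d').
Proof. by rewrite /mx2 mulmx_block -!scalar_mxM -!raddfD. Qed.

Lemma trmx2 (R : realType) (a b c d : R) : (mx2 a b c d)^T = mx2 a c b d.
Proof. by rewrite /mx2 tr_block_mx !tr_scalar_mx. Qed.

Lemma mul_plane_map (R : realType) (m : nat) (A B : 'M[R]_(1 + 1)) :
  plane_map m A *m plane_map m B = plane_map m (A *m B).
Proof.
by rewrite /plane_map mulmx_block !(mulmx0, mul0mx, addr0, add0r) mul1mx.
Qed.

Lemma tr_plane_map (R : realType) (m : nat) (A : 'M[R]_(1 + 1)) :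
  (plane_map m A)^T = plane_map m A^T.
Proof. by rewrite /plane_map tr_block_mx !trmx0 trmx1. Qed.

Lemma diag_plane_map (R : realType) (m : nat) (x y : R) :
  diag_mx (row_mx (row_mx x%:M y%:M) (const_mx 1)) = plane_map m (mx2 x 0 0 y).
Proof.
rewrite !diag_mx_row diag_const_mx /plane_map /mx2.
congr (block_mx (block_mx _ _ _ _) _ _ _);
  by apply/matrixP => i j; rewrite !mxE !ord1 ?mulr1n ?mul0rn.
Qed.

Lemma plane_map1 (R : realType) (m : nat) :
  plane_map m (mx2 1 0 0 1) = 1%:M :> 'M[R]_(1 + 1 + m).
Proof.
rewrite [RHS]scalar_mx_block [X in block_mx X]scalar_mx_block.
by rewrite /plane_map /mx2 raddf0.
Qed.

Definition twist (R : realType) (m : nat) (d s p : R) : 'M[R]_(1 + 1 + m) :=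
  plane_map m (mx2 (- p) d (- d) s).

Lemma det_twist (R : realType) (m : nat) (d s p : R) :
  \det (twist m d s p) = d ^+ 2 - p * s.
Proof.
rewrite /twist /plane_map det_ublock det1 mulr1 (expand_det_row _ (lshift 1 0)).
rewrite big_split_ord /= !big_ord1 /cofactor !det_mx11.
have minorE i j (A : 'M[R]_(1 + 1)) :
    row' i (col' j A) 0 0 = A (lift i 0) (lift j 0) by rewrite !mxE.
rewrite !minorE.
have -> : lift (lshift 1 ord0 : 'I_(1 + 1)) 0 = rshift 1 0 by exact: val_inj.
have -> : lift (rshift 1 ord0 : 'I_(1 + 1)) 0 = lshift 1 0 by exact: val_inj.
rewrite /mx2 block_mxEul block_mxEur block_mxEdl block_mxEdr !mxE /=.
by ring.
Qed.

(** Up to the sign of its first row, the planar block is the symmetric matrix S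
    with rows (p, -d) and (-d, s), of eigenvalues x and -y. The block and S have
    the same F^T F = S^2, which is diagonal in the orthonormal basis (u, v),
    (-v, u) where (u, v) is the eigenvector (d, p - x) of S divided by its
    length. *)
Lemma frobenius_sq_log_twist (R : realType) (m : nat) (d s p x y : R) :
  d != 0 -> 0 < x -> 0 < y -> p + s = x - y -> d ^+ 2 - p * s = x * y ->
  frobenius_sq (logmx (right_stretch (twist m d s p))) = ln x ^+ 2 + ln y ^+ 2.
Proof.
move=> d_neq0 x_gt0 y_gt0 trS detS.
have sE : s = x - y - p by rewrite -trS; ring.
have d2 : d ^+ 2 = (p + y) * (x - p) by move: detS; rewrite sE; lra.
pose N := Num.sqrt (d ^+ 2 + (p - x) ^+ 2).
have N2_gt0 : 0 < d ^+ 2 + (p - x) ^+ 2.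
  by rewrite ltr_pwDl ?sqr_ge0// lt_neqAle sqr_ge0 eq_sym sqrf_eq0 d_neq0.
have N_neq0 : N != 0 by rewrite gt_eqF// sqrtr_gt0.
have N2 : N ^+ 2 = (x + y) * (x - p).
  by rewrite sqr_sqrtr ?ltW// d2; ring.
have xy_neq0 : x + y != 0 by rewrite gt_eqF// addr_gt0.
have xp_neq0 : x - p != 0.
  by apply: contra_neq N_neq0 => xp0; apply/eqP; rewrite -sqrf_eq0 N2 xp0 mulr0.
pose u := d / N; pose v := (p - x) / N.
have uu : u ^+ 2 = (p + y) / (x + y).
  by rewrite /u exprMn exprVn N2 d2; field; rewrite xy_neq0 xp_neq0.
have vv : v ^+ 2 = (x - p) / (x + y).
  by rewrite /v exprMn exprVn N2; field; rewrite xy_neq0 xp_neq0.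
have uv : u * v = - d / (x + y).
  rewrite /u /v mulrACA -invfM -expr2 N2.
  by field; rewrite xy_neq0 xp_neq0.
pose Q := plane_map m (mx2 u v (- v) u).
have orthoQ : Q *m Q^T = 1%:M.
  rewrite tr_plane_map mul_plane_map trmx2 mulmx2.
  rewrite -plane_map1; congr (plane_map _ (mx2 _ _ _ _)); [|ring..|].
    by rewrite -!expr2 uu vv; field.
  by rewrite mulrNN addrC -!expr2 uu vv; field.
pose sv : 'rV[R]_(1 + 1 + m) := row_mx (row_mx x%:M y%:M) (const_mx 1).
rewrite (@frobenius_sq_log_stretch R _ Q _ sv orthoQ).
- rewrite !big_split_ord/= !big_ord1 big1 ?addr0 => [|i _].
    by rewrite row_mxEl row_mxEl row_mxEl row_mxEr !mxE !mulr1n.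
  by rewrite row_mxEr mxE ln1 expr0n.
- move=> i; rewrite /sv mxE; case: fintype.split => [j|j]; rewrite mxE ?ltr01//.
  by case: fintype.split => k; rewrite mxE !ord1 mulr1n.
- have -> : map_mx (fun z => z ^+ 2) sv =
      row_mx (row_mx (x ^+ 2)%:M (y ^+ 2)%:M) (const_mx 1).
    rewrite /sv !map_row_mx map_const_mx expr1n.
    congr (row_mx (row_mx _ _) _);
      by apply/rowP => i; rewrite !mxE !ord1 !mulr1n.
  rewrite diag_plane_map /twist /Q !tr_plane_map !mul_plane_map !trmx2 !mulmx2.
  congr (plane_map _ (mx2 _ _ _ _)).
  + transitivity (p ^+ 2 + d ^+ 2); first by ring.
    transitivity (u ^+ 2 * x ^+ 2 + v ^+ 2 * y ^+ 2); last by ring.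
    by rewrite uu vv d2; field.
  + transitivity (- d * (x - y)); first by rewrite -trS; ring.
    transitivity (u * v * (x ^+ 2 - y ^+ 2)); last by ring.
    by rewrite uv; field.
  + transitivity (- d * (x - y)); first by rewrite -trS; ring.
    transitivity (u * v * (x ^+ 2 - y ^+ 2)); last by ring.
    by rewrite uv; field.
  + transitivity (d ^+ 2 + s ^+ 2); first by ring.
    transitivity (v ^+ 2 * x ^+ 2 + u ^+ 2 * y ^+ 2); last by ring.
    by rewrite uu vv d2 sE; field.
Qed.

Lemma twist_affine (R : realType) (m : nat) (d s q a b : R) :
  q *: twist m d s a + (1 - q) *: twist m d s b =
  twist m d s (q * a + (1 - q) * b).
Proof.
rewrite /twist /plane_map /mx2 !scale_block_mx !add_block_mx !scaler0 !addr0.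
rewrite !scale_scalar_mx -!raddfD /=.
by congr (block_mx (block_mx _%:M _%:M _%:M _%:M) _ _ _%:M); ring.
Qed.

Lemma block_mx_scale_delta (R : pzRingType) (m n k l : nat) (c : R) i j :
  block_mx (c *: delta_mx i j : 'M[R]_(m, n)) 0 0 0 =
  c *: delta_mx (lshift k i) (lshift l j).
Proof.
apply/matrixP => i' j'; case: (split_ordP i') => x ->;
  case: (split_ordP j') => y ->.
- by rewrite block_mxEul !mxE !eq_lshift.
- by rewrite block_mxEur !mxE eq_rlshift andbF mulr0.
- by rewrite block_mxEdl !mxE eq_rlshift mulr0.
- by rewrite block_mxEdr !mxE eq_rlshift mulr0.
Qed.

Lemma rank_twistB (R : realType) (m : nat) (d s a b : R) :
  a != b -> \rank (twist m d s a - twist m d s b) = 1%N.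
Proof.
move=> ab; pose o : 'I_(1 + 1 + m) := lshift m (lshift 1 0).
have -> : twist m d s a - twist m d s b = (b - a) *: delta_mx o o.
  rewrite /twist /plane_map /mx2 !opp_block_mx !add_block_mx !subrr.
  rewrite -raddfB opprK addrC /o -!block_mx_scale_delta.
  congr (block_mx (block_mx _ _ _ _) _ _ _).
  by apply/matrixP => i j; rewrite !mxE !ord1 mulr1.
by rewrite mxrank_scale_nz ?mxrank_delta// subr_eq0 eq_sym.
Qed.

(** Rank-one convexity applies as soon as the determinant is positive at the two
    ends, since it is affine in p. *)
Lemma rank_one_convex_twist (R : realType) (m : nat)
    (W : 'M[R]_(1 + 1 + m) -> R) (d s a b q : R) :
  rank_one_convex W -> a != b -> 0 <= q <= 1 ->
  0 < d ^+ 2 - a * s -> 0 < d ^+ 2 - b * s ->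
  W (twist m d s (q * a + (1 - q) * b)) <=
    q * W (twist m d s a) + (1 - q) * W (twist m d s b).
Proof.
move=> convW ab /andP[q_ge0 q_le1] a_gt0 b_gt0.
set A := twist m d s a; set B := twist m d s b.
have segAB : segment A B `<=` GLplus.
  move=> _ [t /= /andP[t_ge0 t_le1] <-].
  rewrite /GLplus /= -[t in t *: B](subKr 1) twist_affine det_twist.
  rewrite (_ : _ - _ = (1 - t) * (d ^+ 2 - a * s) + t * (d ^+ 2 - b * s));
    last by ring.
  have [->|t_neq0] := eqVneq t 0; first by lra.
  apply: ltr_wpDl; first by rewrite mulr_ge0 ?(ltW a_gt0)// subr_ge0.
  by rewrite mulr_gt0// lt_neqAle eq_sym t_neq0.
have rankAB : \rank (B - A) = 1%N by rewrite rank_twistB// eq_sym.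
have segA : A \in segment A B.
  by apply/mem_set; exists 0;
    [rewrite /= lexx ler01|rewrite subr0 scale1r scale0r addr0].
have segB : B \in segment A B.
  by apply/mem_set; exists 1;
    [rewrite /= lexx ler01|rewrite subrr scale1r scale0r add0r].
have := convW A B segAB rankAB (Itv01 q_ge0 q_le1) A B segA segB.
by rewrite -twist_affine.
Qed.

(** * The three points *)

Lemma ln_pow2_pow3 (R : realType) (i j : nat) :
  ln (2 ^+ i * 3 ^+ j : R) = i%:R * ln 2 + j%:R * ln 3.
Proof.
by rewrite lnM ?posrE ?exprn_gt0// !lnXn// !mulr_natl.
Qed.

Lemma ln3_lt (R : realType) : 17 * ln 3 < 27 * ln (2 : R).
Proof.
by rewrite !mulr_natl -!lnXn// ltr_ln ?posrE ?exprn_gt0//; lra.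
Qed.

(** The weights 8/45 and 37/45 come from the determinants 2^6 3^7, 2^12 3^4 and
    2^9 3^6 of the planar blocks, which are affine in p: divided by 2^6 3^4 they
    are 27, 64 and 72, and 64 = 8/45 * 27 + 37/45 * 72. *)
Lemma not_rank_one_convex_hencky (R : realType) (m : nat) :
  ~ rank_one_convex (fun F : 'M[R]_(1 + 1 + m) =>
      expR (frobenius_sq (logmx (right_stretch F)))).
Proof.
set W := (X in rank_one_convex X) => convW.
(* The number 2 ^+ 10 * 455 is 465920. *)
pose d : R := Num.sqrt (2 ^+ 10 * 455).
have d2 : d ^+ 2 = 2 ^+ 10 * 455.
  exact: sqr_sqrtr (mulr_ge0 (exprn_ge0 _ (ler0n _ _)) (ler0n _ _)).
have d_neq0 : d != 0 by rewrite -sqrf_eq0 d2 mulf_neq0 ?expf_neq0 ?pnatr_eq0.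
pose v (i j : nat) : R := 2 ^+ i * 3 ^+ j.
have v_gt0 i j : 0 < v i j by rewrite mulr_gt0 ?exprn_gt0.
(* The parameter p of a matrix whose singular values are v i j and v k l. *)
pose p (i j k l : nat) : R := v i j - v k l - 64.
pose x := ln (2 : R); pose y := ln (3 : R).
have detE i j k l : (v i j - 64) * (v k l + 64) = 2 ^+ 10 * 455 ->
    d ^+ 2 - p i j k l * 64 = v i j * v k l.
  by rewrite d2 => <-; rewrite /p; ring.
have WE i j k l : (v i j - 64) * (v k l + 64) = 2 ^+ 10 * 455 ->
    W (twist m d 64 (p i j k l)) =
    expR ((i%:R * x + j%:R * y) ^+ 2 + (k%:R * x + l%:R * y) ^+ 2).
  move=> /detE vE; rewrite -!ln_pow2_pow3; congr expR.
  apply: frobenius_sq_log_twist vE => //; [exact: v_gt0..|].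
  by rewrite /p; ring.
have v1 : (v 6%N 4%N - 64) * (v 0%N 3%N + 64) = 2 ^+ 10 * 455.
  by rewrite /v; ring.
have v0 : (v 8%N 2%N - 64) * (v 4%N 2%N + 64) = 2 ^+ 10 * 455.
  by rewrite /v; ring.
have v2 : (v 6%N 3%N - 64) * (v 3%N 3%N + 64) = 2 ^+ 10 * 455.
  by rewrite /v; ring.
have p_neq : p 6%N 4%N 0%N 3%N != p 6%N 3%N 3%N 3%N.
  rewrite /p /v -subr_eq0 (_ : _ - _ = 3 ^+ 6 * 5); last by ring.
  by rewrite mulf_neq0 ?expf_neq0 ?pnatr_eq0.
have q01 : 0 <= (8 / 45 : R) <= 1.
  by rewrite divr_ge0//= ler_pdivrMr// mul1r ler_nat.
have := rank_one_convex_twist (d := d) (s := 64) convW p_neq q01.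
rewrite (detE _ _ _ _ v1) (detE _ _ _ _ v2).
have vv_gt0 i j k l : 0 < v i j * v k l by apply: mulr_gt0; exact: v_gt0.
move=> /(_ (vv_gt0 _ _ _ _) (vv_gt0 _ _ _ _)).
have -> : 8 / 45 * p 6%N 4%N 0%N 3%N +
    (1 - 8 / 45) * p 6%N 3%N 3%N 3%N = p 8%N 2%N 4%N 2%N.
  by rewrite /p /v; field.
(* Without bodies, distinct values of W are told apart at once. *)
clearbody W p v.
rewrite (WE _ _ _ _ v0) (WE _ _ _ _ v1) (WE _ _ _ _ v2).
have y_lt : 17 * y < 27 * x by exact: ln3_lt.
have x_gt0 : 0 < x by rewrite ln_gt0// ltr1n.
have y_gt0 : 0 < y by rewrite ln_gt0// ltr1n.
(* The differences of the exponents are 44 x^2 - 17 y^2 and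
   35 x^2 - 6 x y - 10 y^2; each is a positive multiple of x^2 plus a positive
   multiple of one of the following products. *)
have xx : 0 < x * x by exact: mulr_gt0.
have slack c e : 0 < c -> 0 < e -> 0 < (27 * x - 17 * y) * (c * x + e * y).
  by move=> c_gt0 e_gt0; rewrite mulr_gt0 ?subr_gt0// addr_gt0 ?mulr_gt0.
have slack1 := slack 27 17 (ltr0n _ _) (ltr0n _ _).
have slack2 := slack 372 170 (ltr0n _ _) (ltr0n _ _).
set h1 := (X in 8 / 45 * expR X); set h2 := (X in (1 - 8 / 45) * expR X).
set h0 := (X in expR X <= _) => le_exp.
have lt1 : expR h1 < expR h0 by rewrite ltr_expR /h1 /h0; lra.
have lt2 : expR h2 < expR h0 by rewrite ltr_expR /h2 /h0; lra.
lra.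
Qed.

Theorem mainTheorem6 (R : realType) (n : nat) (hn : n = 2%N \/ n = 3%N) :
  ~ rank_one_convex
      (fun F : 'M[R]_n => expR (frobenius_sq (logmx (right_stretch F)))).
Proof.
case: hn => ->.
- exact: (@not_rank_one_convex_hencky R 0).
- exact: (@not_rank_one_convex_hencky R 1).
Qed.
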